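(* Suppose that, in the interpretation functor $[\![-]\!]$ described below, the clause for disjunction is replaced by: $[\![\phi \vee \psi]\!]$ is the coproduct $[\![\phi]\!] + [\![\psi]\!]$ in the presheaf category $[\mathcal{W}^{op},\mathbf{Set}]$, given pointwise by disjoint union. Then, for atoms $p,q,r$, there is a natural transformation from $[\![p \supset (q \vee r)]\!]$ to $[\![(p \supset q) \vee (p \supset r)]\!]$.
   Context: A base $\mathcal{B}$ is a countable set of atomic rules $((P_1 \Rightarrow q_1),\ldots,(P_n \Rightarrow q_n)) \Rightarrow r$, where the $P_i$ are sets of atoms and $q_i, r$ are atoms. Derivations of an atom from a context $(X\!:\!P)$ of atoms in a base are generated by two rules. (Ref) gives $(X\!:\!P), x\!:\!p \vdash_{\mathcal{B}} x\!:\!p$. (App) states: if $(X\!:\!P),(X_i\!:\!P_i) \vdash_{\mathcal{B}} \Phi_i\!:\!q_i$ for each $i$, then $(X\!:\!P)\vdash_{\mathcal{B}} \Phi_{\mathcal{R}}(\Phi_1,\ldots,\Phi_n)\!:\!r$, for a rule $\mathcal{R}$ of $\mathcal{B}$. $\mathcal{W}$ is the category whose objects are pairs $(\mathcal{B},(X\!:\!P))$ of a base and a context. A morphism $(\mathcal{B},(X\!:\!P)) \to (\mathcal{C},(Y\!:\!Q))$ consists of an inclusion $\mathcal{C}\subseteq\mathcal{B}$ together with derivations $X\!:\!P \vdash_{\mathcal{B}} \Phi_i\!:\!q_i$ for each $q_i \in Q$. Composition is substitution. Formulae are interpreted as presheaves $[\![\phi]\!]:\mathcal{W}^{op}\to\mathbf{Set}$.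 - For an atom $p$, $[\![p]\!](\mathcal{B},(X\!:\!P))$ is the set of derivations $(X\!:\!P)\vdash_{\mathcal{B}}\Phi\!:\!p$, with action on morphisms given by substitution. - Conjunction is interpreted as the product of presheaves. - Implication is interpreted as the exponential of presheaves: $(F\supset G)(w)=\mathrm{Nat}(\hom(-,w)\times F, G)$. In the original interpretation, $[\![\phi\vee\psi]\!]$ is $\forall_{\mathcal{A}}$ (the product over all atoms $p$) of $([\![\phi]\!]\supset[\![p]\!])\supset(([\![\psi]\!]\supset[\![p]\!])\supset[\![p]\!])$. The theorem considers replacing this with the coproduct. *)

(* Defs.v *)
From mathcomp Require Import all_boot finmap.
From mathcomp Require Import boolp classical_sets cardinality.

Set Implicit Arguments.
Unset Strict Implicit.
Unset Printing Implicit Defensive.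

Local Open Scope classical_set_scope.
#[local] Obligation Tactic := idtac.

Record category := Category {
  obj :> Type;
  hom : obj -> obj -> Type;
  idm : forall a, hom a a;
  compose : forall u v w, hom v w -> hom u v -> hom u w;
  comp_idl : forall a b (f : hom a b), compose (idm b) f = f;
  comp_idr : forall a b (f : hom a b), compose f (idm a) = f;
  comp_assoc : forall a b c d (h : hom c d) (g : hom b c) (f : hom a b),
    compose h (compose g f) = compose (compose h g) f
}.
Arguments hom {_}.
Arguments idm {_}.
Arguments compose {_ _ _ _}.

(** The category Set is rendered by types and functions with Leibniz equality. *)
Record presheaf (C : category) := Presheaf {
  psh_obj :> C -> Type;
  act : forall a b : C, hom a b -> psh_obj b -> psh_obj a;
  act_id : forall a (x : psh_obj a), act (idm a) x = x;
  act_comp : forall a b c (g : hom b c) (f : hom a b) (x : psh_obj c),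
    act (compose g f) x = act f (act g x)
}.
Arguments act {_} _ {_ _}.

Record nat_trans (C : category) (F G : presheaf C) := NatTrans {
  component :> forall a : C, F a -> G a;
  naturality : forall (a b : C) (f : hom a b) (x : F b),
    component (act F f x) = act G f (component x)
}.

Lemma nat_trans_ext (C : category) (F G : presheaf C) (s t : nat_trans F G) :
  (forall a (x : F a), s a x = t a x) -> s = t.
Proof.
case: s t => [s ns] [t nt] /= st.
have e : s = t.
  by apply: functional_extensionality_dep => a; apply: funext => x; apply: st.
by subst t; congr NatTrans; apply: Prop_irrelevance.
Qed.

Section PresheafOperations.
Variable C : category.
Implicit Types F G : presheaf C.

Program Definition yoneda (w : C) : presheaf C :=
  @Presheaf C (fun v => hom v w) (fun a b f g => compose g f) _ _.
Next Obligation. by move=> w a x /=; rewrite comp_idr. Qed.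
Next Obligation. by move=> w a b c g f x /=; rewrite comp_assoc. Qed.

Program Definition psh_prod F G : presheaf C :=
  @Presheaf C (fun w => (F w * G w)%type)
    (fun a b f x => (act F f x.1, act G f x.2)) _ _.
Next Obligation. by move=> F G a [x y] /=; rewrite !act_id. Qed.
Next Obligation. by move=> F G a b c g f [x y] /=; rewrite !act_comp. Qed.

Program Definition psh_coprod F G : presheaf C :=
  @Presheaf C (fun w => (F w + G w)%type)
    (fun a b f x => match x with
                    | inl y => inl (act F f y)
                    | inr z => inr (act G f z)
                    end) _ _.
Next Obligation. by move=> F G a [x|x] /=; rewrite act_id. Qed.
Next Obligation. by move=> F G a b c g f [x|x] /=; rewrite act_comp. Qed.

Program Definition exp_act F G (a b : C) (f : hom a b)
    (t : nat_trans (psh_prod (yoneda b) F) G) :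
    nat_trans (psh_prod (yoneda a) F) G :=
  @NatTrans C (psh_prod (yoneda a) F) G (fun v x => t v (compose f x.1, x.2)) _.
Next Obligation.
move=> F G a b f t u v g [h x] /=; rewrite comp_assoc.
exact: (naturality t g (compose f h, x)).
Qed.

Program Definition psh_exp F G : presheaf C :=
  @Presheaf C (fun w => nat_trans (psh_prod (yoneda w) F) G) (@exp_act F G) _ _.
Next Obligation.
by move=> F G a t; apply: nat_trans_ext => v [h x] /=; rewrite comp_idl.
Qed.
Next Obligation.
move=> F G a b c g f t; apply: nat_trans_ext => v [h x] /=.
by rewrite comp_assoc.
Qed.

End PresheafOperations.

(** [Rule [:: (P_1, q_1); ..; (P_n, q_n)] r] stands for
    ((P_1 => q_1), .., (P_n => q_n)) => r, with finite sets P_i. *)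
Record rule (A : choiceType) := Rule {
  premises : seq ({fset A} * A);
  conclusion : A
}.

Record base (A : choiceType) := Base {
  rules : set (rule A);
  base_countable : countable rules
}.

(** A context (X : P) lists the atoms assigned to its variables.  Variables are
    positions in that list (typed de Bruijn indices), so derivations are taken
    up to renaming of the variables bound in an application. *)
Definition context (A : choiceType) := seq A.

Inductive var (A : choiceType) : context A -> A -> Type :=
| VZ G p : var (p :: G) p
| VS G q p : var G p -> var (q :: G) p.
Arguments VZ {A}.
Arguments VS {A G} q {p}.

Definition premise (A : choiceType) (R : rule A) (i : 'I_(size (premises R))) :=
  tnth (in_tuple (premises R)) i.
Arguments premise {A}.

(** The context (X : P), (X_i : P_i), with one fresh variable for each element
    of P_i. *)
Definition extend (A : choiceType) (G : context A) (P : {fset A}) : context A :=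
  G ++ enum_fset P.

Inductive deriv (A : choiceType) (B : base A) : context A -> A -> Type :=
| Ref G p : var G p -> deriv B G p
| App G (R : rule A) : rules B R ->
    (forall i : 'I_(size (premises R)),
       deriv B (extend G (premise R i).1) (premise R i).2) ->
    deriv B G (conclusion R).
Arguments Ref {A} B {G p}.
Arguments App {A B} G R.

Section Substitution.
Variable A : choiceType.
Implicit Types (B C D : base A) (G H K L : context A) (p q : A).

Definition renaming G H := forall p, var G p -> var H p.
Definition subst B G H := forall p, var G p -> deriv B H p.

Fixpoint inl_var G H p (x : var G p) : var (G ++ H) p :=
  match x in var G p return var (G ++ H) p with
  | VZ G p => VZ (G ++ H) p
  | VS G q p y => VS q (inl_var H y)
  end.

Fixpoint inr_var G H p (x : var H p) : var (G ++ H) p :=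
  match G return var (G ++ H) p with
  | [::] => x
  | q :: G' => VS q (inr_var G' x)
  end.

Definition cons_var (T : A -> Type) G p (t : T p) (f : forall q, var G q -> T q) :
    forall q, var (p :: G) q -> T q :=
  fun q x =>
    match x in var K q0 return
      (match K return Type with
       | [::] => unit
       | p' :: G' => T p' -> (forall q, var G' q -> T q) -> T q0
       end) with
    | VZ G' p' => fun t _ => t
    | VS G' q' p' y => fun _ f => f p' y
    end t f.

Fixpoint split_var (T : A -> Type) G H :
    (forall p, var G p -> T p) -> (forall p, var H p -> T p) ->
    forall p, var (G ++ H) p -> T p :=
  match G return (forall p, var G p -> T p) -> (forall p, var H p -> T p) ->
    forall p, var (G ++ H) p -> T p with
  | [::] => fun _ g => g
  | q :: G' => fun f g =>
      cons_var (f q (VZ G' q)) (split_var (fun p x => f p (VS q x)) g)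
  end.

Definition lift_ren G H (s : renaming G H) (P : {fset A}) :
    renaming (extend G P) (extend H P) :=
  split_var (T := var (extend H P))
    (fun p x => inl_var (enum_fset P) (s p x)) (fun p x => inr_var H x).

Arguments lift_ren {G H} s P [p] _.

Fixpoint rename B G p (d : deriv B G p) : forall H, renaming G H -> deriv B H p :=
  match d in deriv _ G p return forall H, renaming G H -> deriv B H p with
  | Ref G p x => fun H s => Ref B (s p x)
  | App G R BR ds => fun H s =>
      App H R BR (fun i => rename (ds i) (lift_ren s (premise R i).1))
  end.

Definition lift_subst B G H (s : subst B G H) (P : {fset A}) :
    subst B (extend G P) (extend H P) :=
  split_var (T := deriv B (extend H P))
    (fun p x => rename (s p x) (fun q y => inl_var (enum_fset P) y))
    (fun p x => Ref B (inr_var H x)).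

Arguments lift_subst {B G H} s P [p] _.

(** Simultaneous substitution along an inclusion of bases. *)
Fixpoint substitute B C (CB : rules C `<=` rules B) G p (d : deriv C G p) :
    forall H, subst B G H -> deriv B H p :=
  match d in deriv _ G p return forall H, subst B G H -> deriv B H p with
  | Ref G p x => fun H s => s p x
  | App G R CR ds => fun H s =>
      App H R (CB R CR)
        (fun i => substitute CB (ds i) (lift_subst s (premise R i).1))
  end.

Lemma ctx_fun_ext (T : A -> Type) G (f g : forall p, var G p -> T p) :
  (forall p x, f p x = g p x) -> f = g.
Proof.
by move=> fg; apply: functional_extensionality_dep => p; apply: funext => x.
Qed.

Lemma var_cons_ind G q (P : forall p, var (q :: G) p -> Prop) :
  P q (VZ G q) -> (forall p y, P p (VS q y)) -> forall p x, P p x.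
Proof.
move=> PZ PS p x; move: P PZ PS.
refine (match x in var K p0 return
  (match K return var K p0 -> Prop with
   | [::] => fun _ => True
   | q' :: G' => fun x0 => forall P : (forall p, var (q' :: G') p -> Prop),
       P q' (VZ G' q') -> (forall p y, P p (VS q' y)) -> P p0 x0
   end x) with VZ _ _ => _ | VS _ _ _ _ => _ end); by [].
Qed.

Lemma var_cat_ind G H (P : forall p, var (G ++ H) p -> Prop) :
  (forall p x, P p (inl_var H x)) -> (forall p x, P p (inr_var G x)) ->
  forall p x, P p x.
Proof.
elim: G P => [|q G IH] P Pl Pr p x; first exact: Pr.
move: p x; apply: var_cons_ind => [|p y]; first exact: (Pl q (VZ G q)).
by apply: (IH (fun p y => P p (VS q y))) => p0 x;
  [exact: (Pl p0 (VS q x)) | exact: Pr].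
Qed.

Lemma split_inl (T : A -> Type) G H f g p (x : var G p) :
  @split_var T G H f g p (inl_var H x) = f p x.
Proof. by elim: x f => [//|{}G q {}p y IH] f /=; rewrite IH. Qed.

Lemma split_inr (T : A -> Type) G H f g p (x : var H p) :
  @split_var T G H f g p (inr_var G x) = g p x.
Proof. by elim: G f => [//|q G IH] f /=; rewrite IH. Qed.

Lemma lift_ren_comp G H K (s : renaming G H) (t : renaming H K) P p x :
  lift_ren t P (lift_ren s P x) = lift_ren (fun p y => t p (s p y)) P x :> var _ p.
Proof.
move: p x; apply: var_cat_ind => p x; rewrite /lift_ren.
  by rewrite !split_inl.
by rewrite !split_inr.
Qed.

Lemma rename_comp B G p (d : deriv B G p) H K (s : renaming G H) (t : renaming H K) :
  rename (rename d s) t = rename d (fun q x => t q (s q x)).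
Proof.
elim: d H K s t => [{}G {}p x|{}G R BR ds IH] H K s t //=.
congr App; apply: functional_extensionality_dep => i; rewrite IH.
by congr rename; apply: ctx_fun_ext => q x; rewrite lift_ren_comp.
Qed.

Lemma substitute_rename B C (CB : rules C `<=` rules B) G p (d : deriv C G p) H K
    (s : renaming G H) (t : subst B H K) :
  substitute CB (rename d s) t = substitute CB d (fun q x => t q (s q x)).
Proof.
elim: d H K s t => [{}G {}p x|{}G R CR ds IH] H K s t //=.
congr App; apply: functional_extensionality_dep => i; rewrite IH.
congr substitute; apply: ctx_fun_ext; apply: var_cat_ind => q x;
  by rewrite /lift_subst /lift_ren ?split_inl ?split_inr.
Qed.

Lemma rename_substitute B C (CB : rules C `<=` rules B) G p (d : deriv C G p) H K
    (s : subst B G H) (t : renaming H K) :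
  rename (substitute CB d s) t = substitute CB d (fun q x => rename (s q x) t).
Proof.
elim: d H K s t => [{}G {}p x|{}G R CR ds IH] H K s t //=.
congr App; apply: functional_extensionality_dep => i; rewrite IH.
congr substitute; apply: ctx_fun_ext; apply: var_cat_ind => q x;
  rewrite /lift_subst ?split_inl ?split_inr /=.
- rewrite !rename_comp; congr rename; apply: ctx_fun_ext => q0 y.
  by rewrite /lift_ren split_inl.
- by rewrite /lift_ren split_inr.
Qed.

Lemma substitute_comp B C D (CB : rules C `<=` rules B) (DC : rules D `<=` rules C) (DB : rules D `<=` rules B)
    G p (d : deriv D G p) H K (s : subst C G H) (t : subst B H K) :
  substitute CB (substitute DC d s) t =
  substitute DB d (fun q x => substitute CB (s q x) t).
Proof.
elim: d H K s t => [{}G {}p x|{}G R DR ds IH] H K s t //=.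
congr App; [exact: Prop_irrelevance|].
apply: functional_extensionality_dep => i; rewrite IH.
congr substitute; apply: ctx_fun_ext; apply: var_cat_ind => q x;
  rewrite /lift_subst ?split_inl ?split_inr /=.
- rewrite substitute_rename rename_substitute.
  by congr substitute; apply: ctx_fun_ext => q0 y; rewrite split_inl.
- by rewrite split_inr.
Qed.

Lemma substitute_id B (BB : rules B `<=` rules B) G p (d : deriv B G p) :
  substitute BB d (fun q x => Ref B x) = d.
Proof.
elim: d => [{}G {}p x|{}G R BR ds IH] //=.
congr App; [exact: Prop_irrelevance|].
apply: functional_extensionality_dep => i; rewrite -[RHS]IH.
congr substitute; apply: ctx_fun_ext; apply: var_cat_ind => q x;
  by rewrite /lift_subst ?split_inl ?split_inr.
Qed.

End Substitution.

Section World.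
Variable A : choiceType.

Definition world : Type := (base A * context A)%type.

(** One derivation is given for each variable of the target context. *)
Record world_hom (v w : world) := WorldHom {
  whom_incl : rules w.1 `<=` rules v.1;
  whom_sub : subst v.1 w.2 v.2
}.

Lemma world_hom_ext (v w : world) (f g : world_hom v w) :
  (forall p x, @whom_sub _ _ f p x = @whom_sub _ _ g p x) -> f = g.
Proof.
case: f g => [i s] [j t] /= st.
by rewrite (ctx_fun_ext st); congr WorldHom; apply: Prop_irrelevance.
Qed.

Definition world_id (w : world) : world_hom w w :=
  @WorldHom w w (@subset_refl _ (rules w.1)) (fun p x => Ref w.1 x).

Definition world_comp (u v w : world) (g : world_hom v w) (f : world_hom u v) :
    world_hom u w :=
  @WorldHom u w (subset_trans (whom_incl g) (whom_incl f))
    (fun p x => substitute (whom_incl f) (@whom_sub _ _ g p x) (@whom_sub _ _ f)).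

Program Definition W : category :=
  @Category world world_hom world_id world_comp _ _ _.
Next Obligation. by move=> a b f; apply: world_hom_ext. Qed.
Next Obligation.
by move=> a b f; apply: world_hom_ext => p x; apply: substitute_id.
Qed.
Next Obligation.
move=> a b c d h g f; apply: world_hom_ext => p x /=.
by symmetry; apply: substitute_comp.
Qed.

Program Definition psh_atom (p : A) : presheaf W :=
  @Presheaf W (fun w : world => deriv w.1 w.2 p)
    (fun (v w : world) (f : world_hom v w) d =>
       substitute (whom_incl f) d (@whom_sub _ _ f)) _ _.
Next Obligation. by move=> p a x; apply: substitute_id. Qed.
Next Obligation. by move=> p a b c g f x; symmetry; apply: substitute_comp. Qed.

End World.

Inductive formula (A : choiceType) : Type :=
| Atom (p : A)
| And (phi psi : formula A)
| Or (phi psi : formula A)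
| Imp (phi psi : formula A).

(** Disjunction is the coproduct of presheaves, replacing the second-order
    clause that quantifies over all atoms. *)
Fixpoint interp (A : choiceType) (phi : formula A) : presheaf (W A) :=
  match phi with
  | Atom p => psh_atom p
  | And phi psi => psh_prod (interp phi) (interp psi)
  | Or phi psi => psh_coprod (interp phi) (interp psi)
  | Imp phi psi => psh_exp (interp phi) (interp psi)
  end.

(* Main.v *)
(** A pair of a morphism [v -> (B, G)] and a derivation of [p] at [v] is the same
    thing as a morphism [v -> (B, p :: G)], so hom(-, w) * [[p]] is representable
    for every world [w].  By Yoneda, an element of [[p]] => (F + G) at [w] is then
    an element of F + G at the representing world, i.e. an element of F or one of G
    there, which in turn is an element of [[p]] => F or of [[p]] => G at [w]. *)
Require Import Defs.
From mathcomp Require Import all_boot.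
From mathcomp Require Import classical_sets.

(** [repr_elt] is the universal element: the two laws make [repr_hom] inverse to restricting it
    along morphisms. *)
Record representation (C : category) (F : presheaf C) := Representation {
  repr_obj : C;
  repr_elt : F repr_obj;
  repr_hom : forall v : C, F v -> hom v repr_obj;
  repr_homK : forall (v : C) (x : F v), act F (repr_hom v x) repr_elt = x;
  repr_actK : forall (v : C) (f : hom v repr_obj),
    repr_hom v (act F f repr_elt) = f
}.
Arguments representation {C}.
Arguments repr_obj {C F}.
Arguments repr_elt {C F}.
Arguments repr_hom {C F} _ {v}.
Arguments repr_homK {C F} _ {v}.
Arguments repr_actK {C F} _ {v}.

(** Both morphisms restrict the universal element to the same element of [F u]. *)
Lemma compose_repr_hom (C : category) (F : presheaf C)
    (R : representation F) (u v : C) (x : F v) (g : hom u v) :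
  compose (repr_hom R x) g = repr_hom R (act F g x).
Proof. by rewrite -[LHS](repr_actK R) act_comp repr_homK. Qed.

Program Definition yoneda_trans (C : category) (F G : presheaf C)
    (R : representation F) (y : G (repr_obj R)) : nat_trans F G :=
  @NatTrans C F G (fun v x => act G (repr_hom R x) y) _.
Next Obligation. by rewrite -compose_repr_hom act_comp. Qed.
Arguments yoneda_trans {C F G}.

Section ExponentOfCoproduct.
Variables (C : category) (F G H : presheaf C).
Variable R : forall w : C, representation (psh_prod (yoneda w) F).

Definition exp_coprod_split (w : C) (t : psh_exp F (psh_coprod G H) w) :
    psh_coprod (psh_exp F G) (psh_exp F H) w :=
  match t (repr_obj (R w)) (repr_elt (R w)) with
  | inl y => inl (yoneda_trans (R w) y)
  | inr z => inr (yoneda_trans (R w) z)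
  end.

(** Under Yoneda, this is the transformation hom(-, f) * id on the represented presheaves. *)
Definition repr_map (a b : C) (f : hom a b) :
    hom (repr_obj (R a)) (repr_obj (R b)) :=
  repr_hom (R b) (compose f (repr_elt (R a)).1, (repr_elt (R a)).2).
Arguments repr_map {a b}.

Lemma exp_act_yoneda_trans (K : presheaf C) (a b : C) (f : hom a b)
    (y : K (repr_obj (R b))) :
  exp_act f (yoneda_trans (R b) y) =
  yoneda_trans (R a) (act K (repr_map f) y).
Proof.
apply: nat_trans_ext => v [h x] /=.
rewrite -act_comp /repr_map compose_repr_hom /=.
(* Writes [h] and [x] as restrictions along one [k] of the components of the universal element. *)
have /= := repr_homK (R a) (h, x).
move: (repr_hom (R a) (h, x)) => k [<- <-].
by rewrite comp_assoc.
Qed.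

Lemma exp_coprod_split_natural (a b : C) (f : hom a b)
    (t : psh_exp F (psh_coprod G H) b) :
  exp_coprod_split a (act _ f t) = act _ f (exp_coprod_split b t).
Proof.
(* By naturality of [t], its value over [a] is a restriction of its value over [b]. Restriction
   preserves the summand, so one case analysis settles both sides. *)
have e : act (psh_exp F (psh_coprod G H)) f t _ (repr_elt (R a)) =
    act (psh_coprod G H) (repr_map f) (t _ (repr_elt (R b))).
  by rewrite -naturality repr_homK.
rewrite /exp_coprod_split e.
by case: (t _ (repr_elt (R b))) => y /=; rewrite exp_act_yoneda_trans.
Qed.

Definition exp_coprod_trans :
    nat_trans (psh_exp F (psh_coprod G H))
              (psh_coprod (psh_exp F G) (psh_exp F H)) :=
  NatTrans exp_coprod_split_natural.

End ExponentOfCoproduct.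

Definition context_extension (A : choiceType) (p : A) (w : W A) :
  representation (psh_prod (yoneda w) (psh_atom p)).
Proof.
pose u : W A := (w.1, p :: w.2).
pose weaken : world_hom u w :=
  @WorldHom A u w (@subset_refl _ (rules w.1)) (fun q x => Ref w.1 (VS p x)).
pose pairing (v : W A) (x : (psh_prod (yoneda w) (psh_atom p)) v) : hom v u :=
  @WorldHom A v u (whom_incl x.1) (cons_var x.2 (@whom_sub _ _ _ x.1)).
apply: (Representation _ (psh_prod (yoneda w) (psh_atom p)) u
  (weaken, Ref w.1 (VZ w.2 p)) pairing).
- by move=> v [h x] /=; congr pair; apply: world_hom_ext.
(* A morphism into [u] is determined by its values at the new variable and at the old ones. *)
- by move=> v f; apply: world_hom_ext; apply: var_cons_ind.
Defined.

Theorem theorem20 (A : choiceType) (p q r : A) :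
  inhabited
    (nat_trans (interp (Imp (Atom p) (Or (Atom q) (Atom r))))
               (interp (Or (Imp (Atom p) (Atom q)) (Imp (Atom p) (Atom r))))).
Proof.
exact (inhabits (exp_coprod_trans _ _ _ _ (context_extension A p))).
Qed.
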